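(* Let $k\ge 2$ and let $G$ be an irregular connected $k$-uniform hypergraph with $n$ vertices and $m$ edges, maximum degree $\Delta$, diameter $D$, spectral radius $\rho(G)$ and principal ratio $\gamma$. Then $$\rho(G)<\Delta-\frac{2(k-1)D(n\Delta-km)\gamma^{-k}+k\left(1-\gamma^{-\frac k2}\right)^2}{2\left(\gamma^{-k}+n-1\right)(k-1)D}.$$
   Context: A $k$-uniform hypergraph $G$ has a finite vertex set $V(G)=\{1,\dots,n\}$ and a set $E(G)$ of edges, each of which is a set of exactly $k$ distinct vertices. The degree $d_i$ of a vertex $i$ is the number of edges containing $i$; $\Delta=\max_i d_i$. $G$ is regular if all vertices have the same degree, and irregular otherwise. A path from $u$ to $v$ is an alternating sequence $v_0e_1v_1e_2\cdots v_{l-1}e_lv_l$ with $v_0=u$, $v_l=v$, where the vertices $v_0,\dots,v_l$ are distinct, the edges $e_1,\dots,e_l$ are distinct, and $v_{i-1},v_i\in e_i$ for $i=1,\dots,l$; its length is $l$. $G$ is connected if there is a path between any two vertices. The distance between two distinct vertices is the length of a shortest path connecting them, and the diameter $D$ is the maximum distance between vertices of $G$. The adjacency tensor of $G$ is $\mathcal{A}_G=(a_{i_1\cdots i_k})$, of order $k$ and dimension $n$, with $a_{i_1\cdots i_k}=\frac{1}{(k-1)!}$ if $\{i_1,\dots,i_k\}\in E(G)$ and $a_{i_1\cdots i_k}=0$ otherwise. For $x\in\mathbb{C}^n$, $\mathcal{A}_Gx^{k-1}\in\mathbb{C}^n$ has $i$-th component $\sum_{i_2,\dots,i_k=1}^n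 a_{ii_2\cdots i_k}x_{i_2}\cdots x_{i_k}$. A number $\lambda\in\mathbb{C}$ is an eigenvalue of $\mathcal{A}_G$ with eigenvector $x\in\mathbb{C}^n\setminus\{0\}$ if $\mathcal{A}_Gx^{k-1}=\lambda x^{[k-1]}$, where $x^{[k-1]}=(x_1^{k-1},\dots,x_n^{k-1})^{\mathrm T}$. The spectral radius $\rho(G)$ is the maximum modulus of the eigenvalues of $\mathcal{A}_G$. For $G$ connected, by the Perron–Frobenius theorem for nonnegative weakly irreducible tensors, $\rho(G)$ is an eigenvalue and there is a unique eigenvector $x=(x_1,\dots,x_n)^{\mathrm T}$ for $\rho(G)$ with all entries positive and $\sum_{i=1}^n x_i^k=1$; it is called the principal eigenvector of $G$. Write $x_{\max}=\max_i x_i$, $x_{\min}=\min_i x_i$. The principal ratio of $G$ is $\gamma=x_{\max}/x_{\min}$. *)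

(* Defs.v *)
From mathcomp Require Import all_boot all_order all_algebra.
From mathcomp Require Import complex.
From mathcomp Require Import reals exp.

Set Implicit Arguments.
Unset Strict Implicit.
Unset Printing Implicit Defensive.

Import Order.TTheory GRing.Theory Num.Theory.

Local Open Scope ring_scope.
Local Open Scope complex_scope.

Record hypergraph (n k : nat) := Hypergraph {
  edges : {set {set 'I_n}};
  edges_uniform : forall e, e \in edges -> #|e| = k
}.

Section Hypergraph.
Variables (n k : nat) (G : hypergraph n k).

Definition degree (v : 'I_n) : nat := #|[set e in edges G | v \in e]|.

Definition max_degree : nat := \max_(v < n) degree v.

Definition regular : Prop := forall u v : 'I_n, degree u = degree v.

(* The alternating sequence v_0 e_1 v_1 ... e_l v_l is encoded as its first
   vertex v_0 together with the list of pairs (e_i, v_i), 1 <= i <= l. *)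
Fixpoint chain (u : 'I_n) (p : seq ({set 'I_n} * 'I_n)) : bool :=
  if p is (e, v) :: p' then
    [&& e \in edges G, u \in e, v \in e & chain v p']
  else true.

Definition hpath (u v : 'I_n) (p : seq ({set 'I_n} * 'I_n)) : bool :=
  [&& chain u p, last u (unzip2 p) == v,
      uniq (u :: unzip2 p) & uniq (unzip1 p)].

Definition hconnected : Prop :=
  forall u v : 'I_n, exists p, hpath u v p.

Definition has_hpath (u v : 'I_n) (l : nat) : bool :=
  [exists p : l.-tuple ({set 'I_n} * 'I_n), hpath u v p].

(* The vertices of a path are distinct, so its length is less than n: this is
   the least length of a path from u to v (and n if there is no such path). *)
Definition distance (u v : 'I_n) : nat := find (has_hpath u v) (iota 0 n).

Definition diameter : nat := \max_(u < n) \max_(v < n) distance u v.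

End Hypergraph.

(* Tensors of order k >= 1 and dimension n: [A i t] is the entry
   a_(i i_2 ... i_k) for t = (i_2, ..., i_k). *)
Definition tensor (K : Type) (n k : nat) := 'I_n -> k.-1.-tuple 'I_n -> K.

(* The product A x^(k-1). *)
Definition tensor_app (K : comNzRingType) n k (A : tensor K n k) (x : 'cV[K]_n)
  : 'cV[K]_n :=
  \col_i \sum_(t : k.-1.-tuple 'I_n) A i t * \prod_(j <- t) x j 0.

Definition tensor_eigenpair (K : comNzRingType) n k (A : tensor K n k)
    (lambda : K) (x : 'cV[K]_n) : Prop :=
  x != 0 /\ tensor_app A x = lambda *: (\col_i x i 0 ^+ k.-1).

Definition adjacency_tensor (K : fieldType) n k (G : hypergraph n k)
  : tensor K n k :=
  fun i t => if (i |: [set j in t]) \in edges G then (k.-1)`!%:R^-1 else 0.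

Section Spectrum.
Variables (R : realType) (n k : nat) (G : hypergraph n k).

Definition eigenvalue_of (lambda : R[i]) : Prop :=
  exists x : 'cV[R[i]]_n, tensor_eigenpair (adjacency_tensor R[i] G) lambda x.

Definition is_spectral_radius (rho : R) : Prop :=
  (exists2 lambda, eigenvalue_of lambda & `|lambda| = rho%:C) /\
  (forall lambda, eigenvalue_of lambda -> `|lambda| <= rho%:C).

Definition is_principal_eigenvector (rho : R) (x : 'cV[R]_n) : Prop :=
  [/\ tensor_eigenpair (adjacency_tensor R[i] G) rho%:C
        (map_mx (real_complex R) x),
      forall i, 0 < x i 0
    & \sum_i x i 0 ^+ k = 1].

End Spectrum.

Section PrincipalRatio.
Variables (R : realType) (n : nat) (x : 'cV[R]_n).

(* For a vector with positive entries, the default values 0 and [vmax] do not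
   affect the maximum and the minimum. *)
Definition vmax : R := \big[Num.max/0]_i x i 0.

Definition vmin : R := \big[Num.min/vmax]_i x i 0.

Definition principal_ratio : R := vmax / vmin.

End PrincipalRatio.

(* Main.v *)
Require Import Defs.
From mathcomp Require Import all_boot all_order all_algebra.
From mathcomp Require Import complex.
From mathcomp Require Import reals exp.
From mathcomp Require Import zify ring lra.

Set Implicit Arguments.
Unset Strict Implicit.
Unset Printing Implicit Defensive.

Import Order.TTheory GRing.Theory Num.Theory.

Local Open Scope ring_scope.

(** Write y_i = x_i^(k/2). Pairing the eigenvalue equation with x, and using
    sum_i x_i^k = 1, gives rho = sum_e k prod_(i in e) x_i, hence
    ([defect_identity])

      Delta - rho = sum_i (Delta - d_i) x_i^k
                    + sum_e (sum_(i in e) x_i^k - k prod_(i in e) x_i).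

    The first sum is at least (n Delta - k m) x_min^k, since
    sum_i (Delta - d_i) = n Delta - k m. In the second, the arithmetic-geometric
    mean inequality, applied to the products y_i y_j over ordered pairs of
    distinct vertices of e rather than to the x_i^k themselves, bounds the
    contribution of e from below by spread(e) / (k - 1), where
    spread(e) = k sum_(i in e) y_i^2 - (sum_(i in e) y_i)^2
    ([AGM_defect_ge_spread]). Two vertices a, b of e force
    spread(e) >= (k/2) (y_a - y_b)^2 ([spread_ge_pair]), so the Cauchy-Schwarz
    inequality along a shortest path from a vertex where x is maximal to one
    where it is minimal yields
    (k/2) (y_max - y_min)^2 <= D sum_e spread(e) ([total_spread_ge]).
    Dividing by x_max^k and using
    1 = sum_i x_i^k <= x_max^k (gamma^-k + n - 1) gives the weak inequality.

    For strictness, if some x_i other than a chosen minimal entry is below x_max,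
    the last estimate is strict. Otherwise y is constant except at one vertex v,
    where it is smaller because G is irregular ([regular_of_constant]). An edge
    through v then has spread exactly (k - 1) (y_max - y_min)^2, which beats
    (k/2) (y_max - y_min)^2 / D unless k = 2 and D = 1; but then G is a complete
    graph, hence regular ([total_spread_gt_outlier]). *)

(** * The adjacency tensor as a sum over edges *)

Lemma card_uniq_tuple (T : finType) (m : nat) (t : m.-tuple T) :
  uniq t -> #|[set j in t]| = m.
Proof. by rewrite cardsE; move=> /card_uniqP ->; rewrite size_tuple. Qed.

(** The tuples that contribute to row [i] through the edge [e] are exactly the
    orderings of [e :\ i]: a tuple of k - 1 entries has no room for a repetition,
    nor for [i] itself. *)
Lemma spanning_tupleE (T : finType) (k : nat) (e : {set T}) (i : T)
    (t : k.-1.-tuple T) : #|e| = k -> i \in e ->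
  (i |: [set j in t] == e) = all (mem (e :\ i)) t && uniq t.
Proof.
move=> ek ie.
have k1 : #|e :\ i| = k.-1 by rewrite -ek (cardsD1 i e) ie.
apply/eqP/andP => [te | [/allP ta tu]].
  have tc : (#|[set j in t]| <= k.-1)%N.
    by rewrite cardsE (leq_trans (card_size t)) ?size_tuple.
  have sub : e :\ i \subset [set j in t] by rewrite -te subDset.
  have /eqP eqt : e :\ i == [set j in t] by rewrite eqEcard sub k1.
  split; first by apply/allP => j jt; rewrite inE eqt inE.
  by apply/card_uniqP; rewrite size_tuple -[RHS]k1 eqt cardsE.
have tc : #|[set j in t]| == k.-1 by rewrite (card_uniq_tuple tu).
have sub : [set j in t] \subset e :\ i.
  by apply/subsetP => j; rewrite inE => /ta.
have /eqP -> : [set j in t] == e :\ i.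
  by rewrite eqEcard sub (eqP tc) k1 leqnn.
by rewrite setD1K.
Qed.

Lemma prod_spanning_tuple (K : comNzRingType) (T : finType) (k : nat)
    (e : {set T}) (i : T) (t : k.-1.-tuple T) (f : T -> K) :
  #|e| = k -> i \in e -> i |: [set j in t] == e ->
  \prod_(j <- t) f j = \prod_(j in e :\ i) f j.
Proof.
move=> ek ie te; have := te; rewrite (spanning_tupleE t ek ie) => /andP[ta tu].
have k1 : #|e :\ i| = k.-1 by rewrite -ek (cardsD1 i e) ie.
have tc : #|[set j in t]| == k.-1 by rewrite (card_uniq_tuple tu).
rewrite big_uniq //=; apply: eq_bigl => j.
suff /setP/(_ j) : [set j in t] = e :\ i by rewrite inE.
apply/eqP; rewrite eqEcard (eqP tc) k1 leqnn andbT.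
by apply/subsetP => l; rewrite inE => /(allP ta).
Qed.

(** Each of the (k - 1)! orderings of [e :\ i] gives the same product, which
    cancels the normalisation of the tensor. *)
Lemma tensor_app_adjacency (K : numFieldType) (n k : nat) (G : hypergraph n k)
    (x : 'cV[K]_n) (i : 'I_n) :
  tensor_app (adjacency_tensor K G) x i 0 =
  \sum_(e in edges G | i \in e) \prod_(j in e :\ i) x j 0.
Proof.
rewrite mxE /adjacency_tensor.
rewrite (bigID (fun t : k.-1.-tuple 'I_n => i |: [set j in t] \in edges G)) /=.
rewrite [X in _ + X]big1 ?addr0; last by move=> t /negPf ->; rewrite mul0r.
rewrite (partition_big (fun t : k.-1.-tuple 'I_n => i |: [set j in t])
  (fun e => (e \in edges G) && (i \in e))) /=; last first.
  by move=> t ->; rewrite setU11.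
apply: eq_bigr => e /andP[eG ie]; have ek := edges_uniform eG.
transitivity (\sum_(t : k.-1.-tuple 'I_n | i |: [set j in t] == e)
   ((k.-1)`!%:R^-1 * \prod_(j in e :\ i) x j 0)).
  apply: eq_big => t; first by case: eqP => [->|]; rewrite ?andbF ?eG.
  by move=> /andP[-> te]; rewrite (prod_spanning_tuple _ ek ie te).
rewrite sumr_const -[LHS]mulr_natr mulrAC.
have -> : #|[pred t : k.-1.-tuple 'I_n | i |: [set j in t] == e]| = (k.-1)`!.
  rewrite (eq_card (B := mem [set t : k.-1.-tuple 'I_n |
     all (mem (e :\ i)) t & uniq t])); last first.
    by move=> t; rewrite [RHS]inE -(spanning_tupleE t ek ie).
  rewrite card_uniq_tuples -ffactnn; congr (_ ^_ _).
  by rewrite -ek (cardsD1 i e) ie.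
by rewrite mulVf ?mul1r // pnatr_eq0 -lt0n fact_gt0.
Qed.

Lemma degree_sum (n k : nat) (G : hypergraph n k) (R : comNzRingType)
    (f : 'I_n -> R) :
  \sum_i (degree G i)%:R * f i = \sum_(e in edges G) \sum_(i in e) f i.
Proof.
rewrite [RHS](exchange_big_dep xpredT) //=; apply: eq_bigr => i _.
rewrite sumr_const mulr_natl; congr (_ *+ _).
by rewrite /degree -cardsE; apply: eq_card => e; rewrite !inE.
Qed.

Section Principal.
Variables (R : realType) (n k : nat) (G : hypergraph n k).
Variables (rho : R) (x : 'cV[R]_n).
Hypothesis xP : is_principal_eigenvector G rho x.

(** The eigenvalue equation lives over the complex numbers; as [rho] and [x] are
    real, it descends to [R]. *)
Lemma principal_edge_sum i :
  \sum_(e in edges G | i \in e) \prod_(j in e :\ i) x j 0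
    = rho * x i 0 ^+ k.-1.
Proof.
case: xP => -[_ /colP/(_ i)]; rewrite tensor_app_adjacency !mxE => eig _ _.
apply: complexI; rewrite rmorph_sum rmorphM rmorphXn /= -eig.
apply: eq_bigr => e _; rewrite rmorph_prod; apply: eq_bigr => j _.
by rewrite mxE.
Qed.

(** Multiply row i by x_i and add up: every edge is counted once for each of its
    k vertices. *)
Lemma principal_rhoE : (0 < k)%N ->
  rho = \sum_(e in edges G) k%:R * \prod_(j in e) x j 0.
Proof.
move=> k0; case: (xP) => _ _ x1.
rewrite -[LHS]mulr1 -[X in rho * X]x1 mulr_sumr.
transitivity (\sum_i \sum_(e in edges G | i \in e) \prod_(j in e) x j 0).
  apply: eq_bigr => i _; rewrite -[k in LHS]prednK // exprSr mulrA.
  rewrite -principal_edge_sum mulr_suml; apply: eq_bigr => e /andP[_ ie].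
  by rewrite [RHS](big_setD1 i) //= mulrC.
rewrite (exchange_big_dep (mem (edges G))) /=; last by move=> i e _ /andP[].
apply: eq_bigr => e eG.
rewrite (eq_bigl (mem e)) => [|i]; last by rewrite eG.
by rewrite sumr_const (edges_uniform eG) mulr_natl.
Qed.

(** For a constant eigenvector the i-th equation reads d_i = rho. *)
Lemma regular_of_constant c : (forall i, x i 0 = c) -> regular G.
Proof.
move=> xc.
have dE i : (degree G i)%:R = rho.
  case: (xP) => _ /(_ i); rewrite xc => c0 _.
  apply: (mulIf (expf_neq0 k.-1 (lt0r_neq0 c0))).
  rewrite -{2}(xc i) -principal_edge_sum.
  rewrite (eq_bigr (fun=> c ^+ k.-1)) => [|e /andP[eG ie]].
    rewrite sumr_const mulr_natl; congr (_ *+ _).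
    by rewrite /degree -cardsE; apply: eq_card => e; rewrite !inE.
  rewrite (eq_bigr (fun=> c)) // prodr_const; congr (_ ^+ _).
  by rewrite -(edges_uniform eG) (cardsD1 i e) ie.
by move=> u v; apply/eqP; rewrite -(eqr_nat R) !dE.
Qed.
End Principal.

(** * Spread of a function on an edge *)

Section Spread.
Variables (R : realFieldType) (T : finType).
Implicit Types (e : {set T}) (y : T -> R).

(** The sum of (y_i - y_j)^2 over unordered pairs in [e]; equivalently, #|e|^2
    times the variance of [y] on [e]. *)
Definition spread e y : R :=
  #|e|%:R * \sum_(i in e) y i ^+ 2 - (\sum_(i in e) y i) ^+ 2.

Lemma spread_shift e y c : spread e (fun i => y i - c) = spread e y.
Proof.
rewrite /spread big_split /= sumr_const.
rewrite (eq_bigr (fun i => y i ^+ 2 - (2 * c) * y i + c ^+ 2)); last first.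
  by move=> i _; ring.
rewrite !big_split /= sumr_const sumrN -mulr_sumr.
rewrite -(mulr_natl (- c)) -(mulr_natl (c ^+ 2)).
move: (#|e|%:R) (\sum_(i in e) y i) => N S; move: (\sum_(i in e) y i ^+ 2) => Q.
ring.
Qed.

Lemma spread_centered e y : (0 < #|e|)%N ->
  let c := (\sum_(i in e) y i) / #|e|%:R in
  spread e y = #|e|%:R * \sum_(i in e) (y i - c) ^+ 2.
Proof.
move=> e0 c; rewrite -(spread_shift e y c) /spread.
rewrite [X in _ - X ^+ 2](_ : _ = 0) ?expr0n ?subr0 //.
rewrite big_split /= sumr_const -mulr_natl mulrN /c mulrC divfK ?subrr //.
by rewrite pnatr_eq0 -lt0n.
Qed.

(** Of the squared deviations from the mean keep only those at [a] and [b];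
    p^2 + q^2 >= (p - q)^2 / 2 does the rest. *)
Lemma spread_ge_pair e y a b : a \in e -> b \in e ->
  #|e|%:R / 2 * (y a - y b) ^+ 2 <= spread e y.
Proof.
move=> ae be; have e0 : (0 < #|e|)%N by apply/card_gt0P; exists a.
rewrite spread_centered //; set c := (\sum_(_ in _) _) / _.
rewrite -mulrA ler_wpM2l ?ler0n //.
have [<-|ab] := eqVneq a b.
  by rewrite subrr expr0n mulr0 sumr_ge0 // => i _; apply: sqr_ge0.
rewrite (big_setD1 a) //= (big_setD1 b) ?inE 1?eq_sym ?ab //= addrA.
apply: (@le_trans _ _ ((y a - c) ^+ 2 + (y b - c) ^+ 2)).
  rewrite -subr_ge0.
  have -> : (y a - c) ^+ 2 + (y b - c) ^+ 2 - 2^-1 * (y a - y b) ^+ 2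
    = 2^-1 * ((y a - c) + (y b - c)) ^+ 2 by field.
  by rewrite mulr_ge0 ?sqr_ge0 // invr_ge0.
by rewrite lerDl sumr_ge0 // => i _; apply: sqr_ge0.
Qed.

(** Spread is invariant under translation, so one may take [M] = 0, leaving a
    single nonzero value. *)
Lemma spread_one_outlier e y v M : v \in e ->
  (forall i, i \in e -> i != v -> y i = M) ->
  spread e y = (#|e|%:R - 1) * (M - y v) ^+ 2.
Proof.
move=> ve yM; rewrite -(spread_shift e y M) /spread.
rewrite !(big_setD1 v ve) /= !big1 => [||i].
- by move: (#|e|%:R) => N; ring.
- by move=> i; rewrite !inE => /andP[iv ie]; rewrite yM ?subrr.
- by rewrite !inE => /andP[iv ie]; rewrite yM ?subrr ?expr0n.
Qed.

(** The mean of y_i y_j over the k(k-1) ordered pairs of distinct elements of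
    [e] is at least their geometric mean, which is the product of the x_i because
    each y_i occurs 2(k-1) times and y_i^2 = x_i^k. The claim is a rearrangement,
    since the y_i y_j add up to (sum y_i)^2 - sum y_i^2. *)
Lemma AGM_defect_ge_spread e (x y : T -> R) : (1 < #|e|)%N ->
  (forall i, 0 <= x i) -> (forall i, 0 <= y i) ->
  (forall i, y i ^+ 2 = x i ^+ #|e|) ->
  spread e y <=
    (#|e|%:R - 1) * (\sum_(i in e) x i ^+ #|e| - #|e|%:R * \prod_(i in e) x i).
Proof.
move=> e1 x0 y0 yx; set k := #|e| in e1 yx *.
have k0 : (0 < k)%N by apply: ltnW.
pose P := [set p : T * T | (p.1 \in e) && (p.2 \in e :\ p.1)].
have eD i : i \in e -> #|e :\ i| = k.-1.
  by move=> ie; rewrite /k (cardsD1 i e) ie.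
have inP p : (p \in P) = (p.1 \in e) && (p.2 \in e :\ p.1) by rewrite inE.
have PN : #|P| = (k * k.-1)%N.
  rewrite -sum1_card (eq_bigl _ _ inP).
  rewrite -(pair_big_dep (mem e) (fun i j => j \in e :\ i) (fun _ _ => 1%N)) /=.
  rewrite (eq_bigr (fun=> k.-1)) => [|i ie]; first by rewrite sum_nat_const.
  by rewrite sum1_card eD.
have Psum : \sum_(p in P) y p.1 * y p.2 =
   (\sum_(i in e) y i) ^+ 2 - \sum_(i in e) y i ^+ 2.
  rewrite (eq_bigl _ _ inP).
  rewrite -(pair_big_dep (mem e) (fun i j => j \in e :\ i) (fun i j => y i * y j)) /=.
  rewrite expr2 mulr_suml -sumrB; apply: eq_bigr => i ie /=.
  by rewrite -mulr_sumr [in RHS](big_setD1 i ie) /= mulrDr expr2 addrC addKr.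
have Pprod : \prod_(p in P) (y p.1 * y p.2) = (\prod_(i in e) x i) ^+ #|P|.
  have ysq : (\prod_(i in e) y i) ^+ 2 = (\prod_(i in e) x i) ^+ k.
    by rewrite -!prodrXl; apply: eq_bigr => i _; rewrite yx.
  rewrite PN exprM -ysq -exprM (eq_bigl _ _ inP).
  rewrite -(pair_big_dep (mem e) (fun i j => j \in e :\ i) (fun i j => y i * y j)) /=.
  rewrite (eq_bigr _ (fun i _ => big_split _ _ _ _ _)) big_split /=.
  (* Exchanging the order turns the factors y_j into a second copy of the y_i. *)
  rewrite [X in _ * X](exchange_big_dep (mem e)) /=; last first.
    by move=> i j _; rewrite inE => /andP[].
  rewrite mul2n -addnn exprD -!prodrXl; congr (_ * _); apply: eq_bigr => i ie.
    by rewrite prodr_const eD.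
  rewrite -(eD i ie) -prodr_const; apply: eq_bigl => j.
  by rewrite !inE ie andbT eq_sym andbC.
have Npos : (0 < #|P|)%N by rewrite PN muln_gt0 k0 -subn1 subn_gt0.
have agm : #|P|%:R * \prod_(i in e) x i <= \sum_(p in P) y p.1 * y p.2.
  rewrite mulrC -ler_pdivlMr ?ltr0n //.
  rewrite -(ler_pXn2r Npos) ?nnegrE ?prodr_ge0 //; last first.
    by rewrite divr_ge0 ?ler0n // sumr_ge0 // => p _; rewrite mulr_ge0.
  rewrite -Pprod; apply: (leif_AGM _).1 => p _; exact: mulr_ge0.
rewrite Psum PN natrM in agm.
have k1E : k.-1%:R = k%:R - 1 :> R by rewrite -subn1 natrB.
rewrite k1E in agm.
rewrite /spread -/k -(eq_bigr _ (fun i _ => yx i)).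
move: agm; set S := \sum_(i in e) _ ^+ 2; set Q := _ ^+ 2; set Z := \prod_(_ in _) _.
by move=> agm; rewrite -subr_ge0 in agm; rewrite -subr_ge0; apply: le_trans agm _; lra.
Qed.
End Spread.

(** * Short paths and telescoping *)

Section Paths.
Variables (n k : nat) (G : hypergraph n k).
Hypothesis Gconn : hconnected G.

(** Lengths below [n] are the ones that [distance] searches, so in a connected
    hypergraph its search succeeds. *)
Lemma hpath_size_lt u v p : hpath G u v p -> (size p < n)%N.
Proof.
case/and4P=> _ _ up _.
have := max_card (mem (u :: unzip2 p)).
by rewrite (card_uniqP up) /= size_map card_ord.
Qed.

Lemma distance_hpath u v : exists2 p, hpath G u v p & size p = distance G u v.
Proof.
have [p up] := Gconn u v; have pn := hpath_size_lt up.
have hs : has (has_hpath G u v) (iota 0 n).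
  apply/hasP; exists (size p); first by rewrite mem_iota.
  by apply/existsP; exists (in_tuple p).
have dn : (distance G u v < n)%N by move: hs; rewrite has_find size_iota.
have := nth_find 0 hs; rewrite nth_iota //.
rewrite add0n => /existsP[q uq]; exists q => //.
exact: size_tuple.
Qed.

Lemma hpath_le_diameter u v : exists2 p, hpath G u v p & (size p <= diameter G)%N.
Proof.
have [p up sp] := distance_hpath u v; exists p => //; rewrite sp.
apply: (leq_trans (leq_bigmax v)).
exact: (leq_bigmax (F := fun u => \max_w distance G u w)).
Qed.

Lemma edge_at (u v : 'I_n) : u != v -> exists2 e, e \in edges G & u \in e.
Proof.
move=> uv; have [[|[e w] p]] := Gconn u v; case/and4P => /=.
  by move=> _ /eqP uv'; rewrite uv' eqxx in uv.
by move=> /and4P[eG ue _ _] _ _ _; exists e.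
Qed.

Lemma diameter_gt0 (u v : 'I_n) : u != v -> (0 < diameter G)%N.
Proof.
move=> uv; have [[|q p] up sp] := hpath_le_diameter u v.
  by case/and4P: up => _ /eqP /= uv'; rewrite uv' eqxx in uv.
exact: leq_trans sp.
Qed.

Lemma diameter1_adjacent u v : (diameter G <= 1)%N -> u != v ->
  exists e, [/\ e \in edges G, u \in e & v \in e].
Proof.
move=> D1 uv; have [p + sp] := hpath_le_diameter u v.
have {sp D1} := leq_trans sp D1.
case: p => [|[e w] [|//]] _ /and4P[/=].
  by move=> _ /eqP uv'; rewrite uv' eqxx in uv.
by move=> /and4P[eG ue we _] /eqP <- _ _; exists e.
Qed.

End Paths.

(** Each vertex [u] lies on exactly the n - 1 edges [set u; v] with v != u. *)
Lemma complete_graph_regular (n : nat) (G : hypergraph n 2) :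
  (forall u v, u != v -> exists e, [/\ e \in edges G, u \in e & v \in e]) ->
  regular G.
Proof.
move=> Gc.
suff dE : forall u, degree G u = n.-1 by move=> u v; rewrite !dE.
move=> u.
have e2 v e : u != v -> e \in edges G -> u \in e -> v \in e -> e = [set u; v].
  move=> uv eG ue ve; apply/esym/eqP; rewrite eqEcard (edges_uniform eG).
  by rewrite cards2 uv subUset !sub1set ue ve.
have -> : n.-1 = #|[set~ u]| by rewrite cardsC1 card_ord.
rewrite -(card_in_imset (f := fun v => [set u; v])); last first.
  move=> v w; rewrite !inE => vu wu /setP/(_ v).
  by rewrite !inE eqxx orbT (negPf vu) => /esym/eqP.
apply: eq_card => f; apply/idP/imsetP.
  rewrite inE => /andP[fG uf].
  have : (0 < #|f :\ u|)%N.
    by have := edges_uniform fG; rewrite (cardsD1 u) uf add1n => -[->].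
  case/card_gt0P => v; rewrite !inE => /andP[vu vf].
  by exists v; rewrite ?inE //; apply: e2; rewrite // eq_sym.
case=> v; rewrite !inE eq_sym => uv ->.
have [e [eG ue ve]] := Gc u v uv.
by rewrite -(e2 v e) // eG ue.
Qed.

Section Telescope.
Variables (R : realFieldType) (n k : nat) (G : hypergraph n k).
Variables (y : 'I_n -> R) (c : R) (g : {set 'I_n} -> R).
Hypothesis c0 : 0 <= c.
Hypothesis g_ge : forall e a b, e \in edges G -> a \in e -> b \in e ->
  c * (y a - y b) ^+ 2 <= g e.

(** Cauchy-Schwarz along a chain of length l: the square of the total increment
    is at most l times the sum of the squared increments, and each of these is
    controlled by the edge of its step. *)
Lemma chain_telescope u p : chain G u p ->
  c * (y u - y (last u (unzip2 p))) ^+ 2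
    <= (size p)%:R * \sum_(e <- unzip1 p) g e.
Proof.
elim: p u => [|[e v] p IH] u /=; first by rewrite subrr expr0n mulr0 mul0r.
case/and4P => eG ue ve /[dup] /IH {IH}; rewrite big_cons.
set w := last v _; set S := \sum_(_ <- _) _; move=> IH pv.
have ge1 := g_ge eG ue ve.
have g0 : 0 <= g e by apply: le_trans ge1; rewrite mulr_ge0 ?sqr_ge0.
case: p @w @S IH pv => [|f p] w S IH pv.
  by rewrite /w /S /= big_nil addr0 mul1r.
rewrite /=; set l : R := (size (f :: p))%:R in IH *.
have l0 : 0 < l by rewrite ltr0n.
have -> : (size p).+2%:R = l + 1 by rewrite -natr1.
rewrite -(ler_pM2l l0).
(* (a + b)^2 <= (l + 1) (a^2 + b^2 / l), cleared of the denominator; the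
   difference of the two sides is the square of l a - b. *)
have key : l * (c * (y u - y w) ^+ 2) =
  (l + 1) * (l * (c * (y u - y v) ^+ 2) + c * (y v - y w) ^+ 2)
   - c * (l * (y u - y v) - (y v - y w)) ^+ 2 by ring.
rewrite key.
apply: (@le_trans _ _ ((l + 1) * (l * g e + l * S))); last first.
  by rewrite mulrCA -mulrDr.
rewrite lerBlDr; apply: ler_wpDr; first by rewrite mulr_ge0 ?sqr_ge0.
by rewrite ler_wpM2l ?addr_ge0 ?ler01 ?(ltW l0) // lerD // ler_wpM2l ?(ltW l0).
Qed.

(** The edges of a path are distinct, so a sum over them is at most the sum over
    all edges. *)
Lemma diameter_telescope u v : hconnected G -> (forall e, e \in edges G -> 0 <= g e) ->
  c * (y u - y v) ^+ 2 <= (diameter G)%:R * \sum_(e in edges G) g e.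
Proof.
move=> Gconn g0; have [p /and4P[ch /eqP <- _ ue] sp] := hpath_le_diameter Gconn u v.
apply: (le_trans (chain_telescope ch)).
have pG e : e \in unzip1 p -> e \in edges G.
  elim: p u ch {sp ue} => //= -[f w] p IH u /and4P[fG _ _ /IH {}IH].
  by rewrite inE => /orP[/eqP ->|].
apply: ler_pM; rewrite ?ler0n ?ler_nat //.
  by rewrite big_seq sumr_ge0 // => e /pG /g0.
rewrite big_uniq //= [leRHS](bigID (mem (unzip1 p))) /=.
rewrite [X in _ <= X + _](eq_bigl (mem (unzip1 p))); last first.
  by move=> e; rewrite /= andb_idl //; apply: pG.
by rewrite lerDl sumr_ge0 // => e /andP[/g0].
Qed.
End Telescope.

(** * The total spread over the edges *)

Section TotalSpread.
Variables (R : realType) (n k : nat) (G : hypergraph n k).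
Hypothesis k2 : (2 <= k)%N.
Hypothesis Gconn : hconnected G.
Variable y : 'I_n -> R.

Lemma edge_spread_ge_pair e a b : e \in edges G -> a \in e -> b \in e ->
  k%:R / 2 * (y a - y b) ^+ 2 <= spread e y.
Proof.
by move=> eG ae be; have := spread_ge_pair y ae be; rewrite (edges_uniform eG).
Qed.

Lemma edge_spread_ge0 e : e \in edges G -> 0 <= spread e y.
Proof.
move=> eG; have /card_gt0P[a ae] : (0 < #|e|)%N.
  by rewrite (edges_uniform eG) ltnW.
by apply: le_trans (edge_spread_ge_pair eG ae ae); rewrite subrr expr0n mulr0.
Qed.

Lemma total_spread_ge u v :
  k%:R / 2 * (y u - y v) ^+ 2
    <= (diameter G)%:R * \sum_(e in edges G) spread e y.
Proof.
apply: diameter_telescope edge_spread_ge0 => //; last exact: edge_spread_ge_pair.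
by rewrite divr_ge0 ?ler0n.
Qed.

(** An edge through [v] has spread (k - 1)(y_u - y_v)^2, so the claim reduces to
    k < 2 D (k - 1), which fails only for k = 2 and D = 1, that is, for complete
    graphs. *)
Lemma total_spread_gt_outlier u v : ~ regular G -> y v < y u ->
  (forall i, i != v -> y i = y u) ->
  k%:R / 2 * (y u - y v) ^+ 2
    < (diameter G)%:R * \sum_(e in edges G) spread e y.
Proof.
move=> Girr yvu yE; have vu : v != u by apply: contraTneq yvu => ->; rewrite ltxx.
have [e eG ve] := edge_at Gconn vu.
have D0 := diameter_gt0 Gconn vu.
have d0 : 0 < (y u - y v) ^+ 2 by rewrite exprn_gt0 // subr_gt0.
apply: (@lt_le_trans _ _ ((diameter G)%:R * ((k%:R - 1) * (y u - y v) ^+ 2))).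
  rewrite mulrA ltr_pM2r //.
  suff : (k < 2 * (diameter G * k.-1))%N.
    rewrite -(ltr_nat R) !natrM -subn1 natrB ?(ltnW k2) //; lra.
  rewrite ltnNge; apply/negP => kD.
  have kE : k = 2 by have := leq_pmull k.-1 D0; lia.
  have DE : (diameter G <= 1)%N.
    have k1E : k.-1 = 1%N by lia.
    by move: kD; rewrite k1E; lia.
  apply: Girr; move: G Gconn DE; rewrite kE => H Hconn D1.
  by apply: complete_graph_regular => a b; apply: diameter1_adjacent.
rewrite ler_wpM2l ?ler0n // (bigD1 e) //=.
rewrite (@spread_one_outlier _ _ _ _ _ (y u) ve) ?(edges_uniform eG) => [|i _].
  by rewrite lerDl sumr_ge0 // => f /andP[/edge_spread_ge0].
exact: yE.
Qed.
End TotalSpread.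

(** * Splitting Delta - rho *)

Section Defect.
Variables (R : realType) (n k : nat) (G : hypergraph n k).
Variables (rho : R) (x : 'cV[R]_n).
Hypothesis k2 : (2 <= k)%N.
Hypothesis xP : is_principal_eigenvector G rho x.

(** x_i^(k/2), as a square root: k may be odd. *)
Definition half_power i : R := Num.sqrt (x i 0 ^+ k).

Local Notation y := half_power.

Lemma principal_gt0 i : 0 < x i 0. Proof. by case: xP. Qed.

Lemma half_power_sqr i : y i ^+ 2 = x i 0 ^+ k.
Proof. by rewrite sqr_sqrtr // exprn_ge0 ?ltW ?principal_gt0. Qed.

(** The gap in the arithmetic-geometric mean inequality for the x_i^k, i in [e],
    multiplied by k. *)
Definition edge_defect (e : {set 'I_n}) : R :=
  \sum_(i in e) x i 0 ^+ k - k%:R * \prod_(i in e) x i 0.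

Lemma defect_identity Delta :
  Delta - rho = \sum_i (Delta - (degree G i)%:R) * x i 0 ^+ k
                + \sum_(e in edges G) edge_defect e.
Proof.
rewrite sumrB -degree_sum -(principal_rhoE xP (ltnW k2)) addrA; congr (_ - _).
rewrite -big_split /=; case: xP => _ _ x1.
rewrite -[LHS]mulr1 -[X in Delta * X]x1 mulr_sumr.
by apply: eq_bigr => i _; rewrite mulrBl subrK.
Qed.

Lemma edge_defect_ge e : e \in edges G ->
  spread e y <= (k%:R - 1) * edge_defect e.
Proof.
move=> eG; have ek := edges_uniform eG.
have := @AGM_defect_ge_spread R 'I_n e (fun i => x i 0) y.
rewrite /edge_defect ek; apply=> // i.
- by rewrite ltW ?principal_gt0.
- exact: sqrtr_ge0.
- exact: half_power_sqr.
Qed.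

End Defect.

Lemma degree_deficit (n k : nat) (G : hypergraph n k) (R : comNzRingType) (Delta : R) :
  \sum_i (Delta - (degree G i)%:R) = n%:R * Delta - k%:R * #|edges G|%:R.
Proof.
rewrite sumrB sumr_const card_ord mulr_natl; congr (_ - _).
rewrite -[LHS](eq_bigr _ (fun i _ => mulr1 _)) degree_sum.
rewrite (eq_bigr (fun=> k%:R)) => [|e eG].
  by rewrite sumr_const mulr_natr.
by rewrite sumr_const (edges_uniform eG).
Qed.

Lemma irregular_lt_max_degree (n k : nat) (G : hypergraph n k) :
  ~ regular G -> exists i, (degree G i < max_degree G)%N.
Proof.
move=> Girr; apply/existsP; apply: contra_notT Girr => /existsPn dE.
have {}dE i : degree G i = max_degree G.
  by apply/eqP; rewrite eqn_leq (leq_bigmax i) leqNgt dE.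
by move=> u v; rewrite !dE.
Qed.

Lemma degree_deficit_gt0 (R : numDomainType) (n k : nat) (G : hypergraph n k) :
  ~ regular G ->
  0 < \sum_i ((max_degree G)%:R - (degree G i)%:R : R).
Proof.
move=> /irregular_lt_max_degree[i di]; rewrite (bigD1 i) //=.
apply: ltr_pwDl; first by rewrite subr_gt0 ltr_nat.
by apply: sumr_ge0 => j _; rewrite subr_ge0 ler_nat (leq_bigmax j).
Qed.

(** A vertex [i0] is needed: in dimension 0 nothing attains the extrema. *)
Lemma principal_ratio_attained (R : realType) (n : nat) (x : 'cV[R]_n) (i0 : 'I_n) :
  (forall i, 0 < x i 0) ->
  exists u v, [/\ forall i, x i 0 <= x u 0, forall i, x v 0 <= x i 0
    & principal_ratio x = x u 0 / x v 0].
Proof.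
move=> x0.
have [u _ uE] := @eq_bigmax _ _ _ 0 i0 xpredT (fun i => x i 0) isT
  (fun i _ => ltW (x0 i)).
have le_vmax i : x i 0 <= vmax x by rewrite /vmax; apply: (le_bigmax _ (fun i => x i 0)).
have [v _ vE] := @eq_bigmin _ _ _ (vmax x) i0 xpredT (fun i => x i 0) isT
  (fun i _ => le_vmax i).
exists u, v; split=> [i|i|].
- by rewrite -uE le_vmax.
- by rewrite -vE; apply: (bigmin_le _ _ (fun i => x i 0)).
- by rewrite /principal_ratio /vmin vE /vmax uE.
Qed.

(** * The bound *)

Theorem theorem3p5 (R : realType) (n k : nat) (hk : (2 <= k)%N)
    (G : hypergraph n k) (Gconn : hconnected G) (Girr : ~ regular G)
    (rho : R) (rhoP : is_spectral_radius G rho)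
    (x : 'cV[R]_n) (xP : is_principal_eigenvector G rho x) :
  let m : R := #|edges G|%:R in
  let Delta : R := (max_degree G)%:R in
  let D : R := (diameter G)%:R in
  let gamma : R := principal_ratio x in
  rho < Delta -
    (2 * (k%:R - 1) * D * (n%:R * Delta - k%:R * m) * gamma ^- k
       + k%:R * (1 - gamma `^ (- (k%:R / 2))) ^+ 2)
    / (2 * (gamma ^- k + n%:R - 1) * (k%:R - 1) * D).
Proof.
cbv zeta; set m : R := #|edges G|%:R; set Delta : R := (max_degree G)%:R.
set D : R := (diameter G)%:R; set gamma : R := principal_ratio x.
have x0 := principal_gt0 xP.
have [i0 _] := irregular_lt_max_degree Girr.
have [u [v [xu xv gammaE]]] := principal_ratio_attained i0 x0.
pose y := half_power k x.
have ysq i : y i ^+ 2 = x i 0 ^+ k := half_power_sqr xP i.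
have y0 i : 0 < y i by rewrite sqrtr_gt0 exprn_gt0.
have xvu : x v 0 < x u 0.
  rewrite lt_neqAle xv andbT; apply/eqP => xvu; apply: Girr.
  apply: (regular_of_constant xP (c := x u 0)) => i.
  by apply/eqP; rewrite eq_le xu -xvu xv.
have yvu : y v < y u by rewrite ltr_sqrt ?exprn_gt0 // ltrXn2r ?ltW ?gtn_eqF 1?ltnW.
have vu : v != u by apply: contraTneq xvu => ->; rewrite ltxx.
have D0 : 0 < D by rewrite ltr0n (diameter_gt0 Gconn vu).
have k1 : 0 < k%:R - 1 :> R by rewrite subr_gt0 ltr1n.
pose A := n%:R * Delta - k%:R * m.
have AE : A = \sum_i (Delta - (degree G i)%:R) by rewrite degree_deficit.
have A0 : 0 < A by rewrite AE degree_deficit_gt0.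
pose F := \sum_(e in edges G) edge_defect k x e.
pose S := \sum_(e in edges G) spread e y.
have defect : A * y v ^+ 2 + F <= Delta - rho.
  rewrite (defect_identity hk xP) lerD2r AE mulr_suml; apply: ler_sum => i _.
  rewrite ysq; apply: ler_wpM2l; last by rewrite lerXn2r // nnegrE ltW.
  by rewrite subr_ge0 ler_nat (leq_bigmax i).
have SF : S <= (k%:R - 1) * F.
  by rewrite mulr_sumr; apply: ler_sum => e; exact: (edge_defect_ge hk xP).
have spread_le : k%:R / 2 * (y u - y v) ^+ 2 <= D * S.
  by apply: total_spread_ge.
(* N / y_u^2 is the factor gamma^-k + n - 1 of the denominator. *)
pose N := y v ^+ 2 + (n%:R - 1) * y u ^+ 2.
have yle i : y i ^+ 2 <= y u ^+ 2 by rewrite !ysq lerXn2r // nnegrE ltW.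
have NE : N = y v ^+ 2 + \sum_(i | i != v) y u ^+ 2.
  rewrite sumr_const cardC1 card_ord -[y u ^+ 2 *+ _]mulr_natl -subn1 natrB //.
  exact: leq_ltn_trans (ltn_ord v).
have norm1 : y v ^+ 2 + \sum_(i | i != v) y i ^+ 2 = 1.
  case: xP => _ _ <-; rewrite [RHS](bigD1 v) //= ysq; congr (_ + _).
  by apply: eq_bigr => i _; rewrite ysq.
have N1 : 1 <= N by rewrite NE -norm1 lerD2l ler_sum.
have strict : 1 < N \/ k%:R / 2 * (y u - y v) ^+ 2 < D * S.
  have [yall|] := boolP [forall i, (i != v) ==> (y i == y u)].
    right; apply: total_spread_gt_outlier => // i iv.
    by move/forallP/(_ i)/implyP/(_ iv)/eqP: yall.
  rewrite negb_forall => /existsP[w]; rewrite negb_imply => /andP[wv ywu]; left.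
  rewrite NE -norm1 ltrD2l (bigD1 w) //= [ltRHS](bigD1 w) //=.
  apply: ltr_leD; last exact: ler_sum.
  by rewrite lt_neqAle yle andbT eqrXn2 ?ltW.
(* P / y_u^2 is the numerator of the statement. *)
pose P := 2 * (k%:R - 1) * D * A * y v ^+ 2 + k%:R * (y u - y v) ^+ 2.
have P0 : 0 < P.
  apply: ltr_pwDl; first by rewrite !mulr_gt0 ?exprn_gt0.
  by rewrite mulr_ge0 ?sqr_ge0.
have PN : P < (Delta - rho) * (2 * (k%:R - 1) * D) * N.
  (* P <= q and 1 <= N, one of the two being strict. *)
  set Q := _ * _ * N; rewrite -/Q; pose q := (Delta - rho) * (2 * (k%:R - 1) * D).
  have qle : 2 * (k%:R - 1) * D * A * y v ^+ 2 + 2 * (D * S) <= q.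
    apply: (@le_trans _ _ ((A * y v ^+ 2 + F) * (2 * (k%:R - 1) * D))).
      rewrite (_ : (_ + F) * _ = 2 * (k%:R - 1) * D * A * y v ^+ 2
                           + 2 * (D * ((k%:R - 1) * F))).
        by rewrite lerD2l ler_pM2l // ler_pM2l.
      by move: (k%:R : R) => K; ring.
    by rewrite ler_wpM2r // !mulr_ge0 // ltW.
  have Pq : P <= q by apply: le_trans qle; rewrite lerD2l; lra.
  have q0 : 0 < q by apply: lt_le_trans Pq.
  case: strict => [N1'|lt_spread].
    by apply: (le_lt_trans Pq); rewrite /Q -/q ltr_pMr.
  apply: (@lt_le_trans _ _ q); last by rewrite /Q -/q ler_peMr // ltW.
  by apply: lt_le_trans qle; rewrite ltrD2l; lra.
have yMp : y u ^+ 2 != 0 by rewrite expf_neq0 // gt_eqF.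
have gammak : gamma ^- k = y v ^+ 2 / y u ^+ 2.
  by rewrite /gamma gammaE !ysq expr_div_n invf_div.
have gammah : gamma `^ (- (k%:R / 2)) = y v / y u.
  have g0 : 0 <= gamma by rewrite /gamma gammaE divr_ge0 ?ltW.
  rewrite powRN powRrM powR_mulrn // powR12_sqrt ?exprn_ge0 //.
  by rewrite -sqrtrV ?exprn_ge0 // gammak !ysq sqrtrM ?exprn_ge0 1?ltW //
    sqrtrV ?exprn_ge0 1?ltW.
rewrite gammak gammah -/A.
suff -> : (2 * (k%:R - 1) * D * A * (y v ^+ 2 / y u ^+ 2)
            + k%:R * (1 - y v / y u) ^+ 2) /
     (2 * (y v ^+ 2 / y u ^+ 2 + n%:R - 1) * (k%:R - 1) * D)
     = P / (2 * (k%:R - 1) * D * N).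
  rewrite ltrBrDr addrC -ltrBrDr ltr_pdivrMr; first by rewrite mulrA.
  by rewrite !mulr_gt0 // (lt_le_trans _ N1).
have y0' : y u != 0 by rewrite gt_eqF.
have N0 : N != 0 by rewrite gt_eqF // (lt_le_trans _ N1).
move: k1 D0 N0; rewrite /P /N; move: (k%:R : R) (n%:R : R) => K n' k1 D0 N0.
by field; rewrite y0' N0 !gt_eqF.
Qed.
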